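(* Let $G$ be a planar graph with a fixed planar embedding $\pi$, and suppose that $G$ contains a square $C\subseteq G$. Then $G$ is a median graph if and only if $G^{\mathrm{in}}_{C,\pi}$ and $G^{\mathrm{out}}_{C,\pi}$ are median graphs.
   Context: All graphs are finite, undirected and simple. A square is a $4$-cycle; $C\subseteq G$ means $C$ is a (not necessarily induced) subgraph of $G$. Given a planar embedding $\pi$ of $G$, the $(G,\pi)$-induced embedding of a subgraph $C$ is the embedding obtained from $\pi$ by removing all vertices and edges of $G$ not in $C$. For a square $C\subseteq G$, $G^{\mathrm{in}}_{C,\pi}$ (resp. $G^{\mathrm{out}}_{C,\pi}$) is the subgraph of $G$ obtained by deleting every vertex and every edge of $G$ located in the outer (resp. inner) face bounded by $C$ with respect to the $(G,\pi)$-induced embedding of $C$; both contain $C$. With $d_G$ the shortest-path distance, a vertex $x$ is a median of $u,v,w\in V(G)$ if $d_G(u,x)+d_G(x,v)=d_G(u,v)$, $d_G(v,x)+d_G(x,w)=d_G(v,w)$ and $d_G(u,x)+d_G(x,w)=d_G(u,w)$. A connected graph is a median graph if every triple of its vertices has a unique median. *)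

(* Defs.v *)
From mathcomp Require Import all_boot all_order all_algebra.
From mathcomp Require Import all_classical all_reals all_analysis.
Import Order.TTheory GRing.Theory Num.Theory.
Import numFieldNormedType.Exports.

Set Implicit Arguments.
Unset Strict Implicit.
Unset Printing Implicit Defensive.

Local Open Scope classical_set_scope.

(* The vertex set is a subset of an ambient finite type T, so that a graph and
   its subgraphs live in the same type. *)
Record sgraph (T : finType) := SGraph {
  vset : {set T};
  adj : rel T;
  adj_sym : symmetric adj;
  adj_irrefl : irreflexive adj;
  adj_vset : forall x y, adj x y -> x \in vset
}.

Definition subgraph (T : finType) (H G : sgraph T) : Prop :=
  vset H \subset vset G /\ subrel (adj H) (adj G).

Definition is_square (T : finType) (C : sgraph T) : Prop :=
  exists s : seq T, [/\ size s = 4%N, uniq s, vset C = [set x in s]%SET &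
    forall x y, adj C x y =
      [&& x \in s, y \in s & (y == next s x) || (x == next s y)]].

Definition connected_graph (T : finType) (G : sgraph T) : Prop :=
  forall u v, u \in vset G -> v \in vset G -> connect (adj G) u v.

Definition has_walk (T : finType) (G : sgraph T) (u v : T) (n : nat) : bool :=
  [exists p : n.-tuple T, path (adj G) u p && (last u p == v)].

(* The least length of a walk from u to v; shortest walks have fewer than #|T|
   edges, and the value is #|T| when v is not reachable from u. *)
Definition dist (T : finType) (G : sgraph T) (u v : T) : nat :=
  find (has_walk G u v) (iota 0 #|T|).

Definition is_median (T : finType) (G : sgraph T) (u v w x : T) : Prop :=
  [/\ x \in vset G,
      (dist G u x + dist G x v)%N = dist G u v,
      (dist G v x + dist G x w)%N = dist G v w &
      (dist G u x + dist G x w)%N = dist G u w].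

Definition median_graph (T : finType) (G : sgraph T) : Prop :=
  connected_graph G /\
  forall u v w, u \in vset G -> v \in vset G -> w \in vset G ->
    exists! x, is_median G u v w x.

Definition simple_arc (R : realType) (A : set (R * R)) (p q : R * R) : Prop :=
  exists gamma : R -> R * R,
    [/\ {within `[0%R, 1%R], continuous gamma},
        {in `[0%R, 1%R] &, injective gamma},
        gamma 0%R = p, gamma 1%R = q & A = gamma @` `[0%R, 1%R]].

(* [curve u v] is the closed arc, endpoints included, drawing the edge uv; the
   values of [pt] and [curve] outside of G are irrelevant.  By [curve_pt], the
   common point in [curve_disj] is an endpoint of both edges. *)
Record embedding (R : realType) (T : finType) (G : sgraph T) := Embedding {
  pt : T -> R * R;
  curve : T -> T -> set (R * R);
  pt_inj : {in vset G &, injective pt};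
  curve_sym : forall u v, adj G u v -> curve u v = curve v u;
  curve_arc : forall u v, adj G u v -> simple_arc (curve u v) (pt u) (pt v);
  curve_pt : forall u v w, adj G u v -> w \in vset G ->
    curve u v (pt w) -> w = u \/ w = v;
  curve_disj : forall u v x y p, adj G u v -> adj G x y ->
    [set u; v]%SET <> [set x; y]%SET -> curve u v p -> curve x y p ->
    exists2 w, w \in vset G & p = pt w
}.

Lemma induced_pt_inj (R : realType) (T : finType) (C G : sgraph T)
    (pi : embedding R G) (sCG : subgraph C G) :
  {in vset C &, injective (pt pi)}.
Proof.
by case: sCG => /fintype.subsetP sV _ x y xC yC; apply: (pt_inj (sV _ xC) (sV _ yC)).
Qed.

Lemma induced_curve_disj (R : realType) (T : finType) (C G : sgraph T)
    (pi : embedding R G) (sCG : subgraph C G) (u v x y : T) (p : R * R) :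
  adj C u v -> adj C x y -> [set u; v]%SET <> [set x; y]%SET ->
  curve pi u v p -> curve pi x y p -> exists2 w, w \in vset C & p = pt pi w.
Proof.
case: sCG => _ sE uv xy ne cu cx.
have [w wG pw] := curve_disj (sE _ _ uv) (sE _ _ xy) ne cu cx.
exists w => //; rewrite pw in cu.
case: (curve_pt (sE _ _ uv) wG cu) => ->; first exact: adj_vset uv.
by apply: (@adj_vset _ C v u); rewrite adj_sym.
Qed.

Definition induced_embedding (R : realType) (T : finType) (C G : sgraph T)
    (pi : embedding R G) (sCG : subgraph C G) : embedding R C :=
  {| pt := pt pi;
     curve := curve pi;
     pt_inj := induced_pt_inj sCG;
     curve_sym := fun u v uv => curve_sym pi (sCG.2 u v uv);
     curve_arc := fun u v uv => curve_arc pi (sCG.2 u v uv);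
     curve_pt := fun u v w uv wC =>
       curve_pt (sCG.2 u v uv) (fintype.subsetP sCG.1 w wC);
     curve_disj := induced_curve_disj sCG |}.

Definition drawing (R : realType) (T : finType) (G : sgraph T)
    (pi : embedding R G) : set (R * R) :=
  [set p | (exists2 v, v \in vset G & p = pt pi v) \/
           (exists u v, adj G u v /\ curve pi u v p)].

Definition face_at (R : realType) (T : finType) (G : sgraph T)
    (pi : embedding R G) (p : R * R) : set (R * R) :=
  connected_component (~` drawing pi) p.

(* For a cycle, the Jordan curve theorem says that there is exactly one bounded
   and one unbounded face, so these are the inner and the outer face. *)
Definition inner_face (R : realType) (T : finType) (C : sgraph T)
    (pi : embedding R C) : set (R * R) :=
  [set p | ~ drawing pi p /\ bounded_set (face_at pi p)].

Definition outer_face (R : realType) (T : finType) (C : sgraph T)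
    (pi : embedding R C) : set (R * R) :=
  [set p | ~ drawing pi p /\ ~ bounded_set (face_at pi p)].

Definition open_curve (R : realType) (T : finType) (G : sgraph T)
    (pi : embedding R G) (u v : T) : set (R * R) :=
  curve pi u v `\` [set pt pi u; pt pi v].

Section Delete.
Variables (R : realType) (T : finType) (G : sgraph T) (pi : embedding R G).
Variable F : set (R * R).

Definition delete_vset : {set T} :=
  [set v in vset G | ~~ `[< F (pt pi v) >]]%SET.

Definition delete_adj : rel T := fun u v =>
  [&& adj G u v, u \in delete_vset, v \in delete_vset &
      ~~ `[< open_curve pi u v `<=` F >]].

Lemma delete_adj_sym : symmetric delete_adj.
Proof.
move=> u v; rewrite /delete_adj (adj_sym G u v).
have [vu /=|//] := boolP (adj G v u).
by rewrite /open_curve (curve_sym pi vu) (setUC [set pt pi u]) andbCA.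
Qed.

Lemma delete_adj_irrefl : irreflexive delete_adj.
Proof. by move=> u; rewrite /delete_adj adj_irrefl. Qed.

Lemma delete_adj_vset u v : delete_adj u v -> u \in delete_vset.
Proof. by case/and4P. Qed.

(* G without the vertices and edges located in the region F; an edge is located
   in F when its arc without the two endpoints is. *)
Definition delete_region : sgraph T :=
  SGraph delete_adj_sym delete_adj_irrefl delete_adj_vset.

End Delete.

Definition G_in (R : realType) (T : finType) (G C : sgraph T)
    (pi : embedding R G) (sCG : subgraph C G) : sgraph T :=
  delete_region pi (outer_face (induced_embedding pi sCG)).

Definition G_out (R : realType) (T : finType) (G C : sgraph T)
    (pi : embedding R G) (sCG : subgraph C G) : sgraph T :=
  delete_region pi (inner_face (induced_embedding pi sCG)).

(* Main.v *)
(* No Jordan curve theorem is needed: an edge outside C is a connected set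
   missing the drawing of C, so it lies in inner or in outer faces only.  Hence
   G is the union of G_in and G_out, they share exactly the vertices of C, and
   every edge of G lies in one of them.

   The rest is a gated amalgam argument, valid for any such decomposition
   G = G1 + G2 along a square.  Median graphs have no triangle and no K_{2,3},
   so in a median graph C has no chord and is gated: every vertex w has a gate g
   in C with d(w, c) = d(w, g) + d(g, c) for all c in C.  Chordlessness makes G1
   and G2 isometric in G, and the gates of the vertices of G2 are then gates for
   the whole of G1.  Consequently G1 is convex in G, which transfers medians
   from G to G1; conversely, two of any three vertices u, v, w lie on the same
   side, say in G1, and the medians of u, v, w in G are those of u, v and the
   gate of w in G1. *)
Require Import Defs.
From mathcomp Require Import all_boot all_order all_algebra.
From mathcomp Require Import all_classical all_reals all_analysis.
From mathcomp Require Import zify.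
Import Order.TTheory GRing.Theory Num.Theory.
Import numFieldNormedType.Exports.

Set Implicit Arguments.
Unset Strict Implicit.
Unset Printing Implicit Defensive.

(** * Walks and the shortest-path distance *)

Lemma adj_vset2 (T : finType) (H : sgraph T) x y :
  adj H x y -> x \in vset H /\ y \in vset H.
Proof. by move=> xy; split; [|rewrite adj_sym in xy]; exact: adj_vset xy. Qed.

Section Walks.
Variables (T : finType) (G : sgraph T).

Lemma has_walkP u v n :
  reflect (exists p, [/\ size p = n, path (adj G) u p & last u p = v])
          (has_walk G u v n).
Proof.
apply: (iffP existsP) => [[p /andP[up /eqP lp]]|[p [sp up lp]]].
  by exists p; rewrite size_tuple.
by exists (tcast sp (in_tuple p)); rewrite val_tcast up lp eqxx.
Qed.

Lemma has_walk_refl u : has_walk G u u 0.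
Proof. by apply/has_walkP; exists [::]. Qed.

Lemma has_walk_adj u v : adj G u v -> has_walk G u v 1.
Proof. by move=> uv; apply/has_walkP; exists [:: v]; rewrite /= uv. Qed.

Lemma has_walk_trans u v w m n :
  has_walk G u v m -> has_walk G v w n -> has_walk G u w (m + n).
Proof.
move=> /has_walkP[p [sp up lp]] /has_walkP[q [sq vq lq]]; apply/has_walkP.
by exists (p ++ q); rewrite size_cat cat_path last_cat sp sq up lp vq lq.
Qed.

Lemma has_walk0 u v : has_walk G u v 0 -> u = v.
Proof. by case/has_walkP => p [/size0nil-> _]. Qed.

Lemma has_walkS u v n :
  has_walk G u v n.+1 -> exists2 w, has_walk G u w n & adj G w v.
Proof.
case/has_walkP => p; case/lastP: p => [[]//|p x].
rewrite size_rcons rcons_path last_rcons => -[[sp] /andP[up px] <-].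
by exists (last u p) => //; apply/has_walkP; exists p.
Qed.

Lemma has_walk1 u v : has_walk G u v 1 -> adj G u v.
Proof. by case/has_walkS => w /has_walk0->. Qed.

Lemma has_walk_sym u v n : has_walk G u v n -> has_walk G v u n.
Proof.
elim: n v => [v /has_walk0->|n IH v /has_walkS[w /IH wu wv]].
  exact: has_walk_refl.
by apply: (@has_walk_trans _ w _ 1) wu; apply: has_walk_adj; rewrite adj_sym.
Qed.

Lemma connect_walk u v : connect (adj G) u v <-> exists n, has_walk G u v n.
Proof.
split=> [/connectP[p up ->]|[n /has_walkP[p [_ up lp]]]].
  by exists (size p); apply/has_walkP; exists p.
by apply/connectP; exists p.
Qed.

Lemma dist_max u v : dist G u v <= #|T|.
Proof. by rewrite -[leqRHS](size_iota 0) find_size. Qed.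

Lemma dist_min u v n : has_walk G u v n -> dist G u v <= n.
Proof.
move=> uv; have [Tn|nT] := leqP #|T| n; first exact: leq_trans (dist_max u v) Tn.
rewrite leqNgt; apply/negP => /(before_find 0).
by rewrite nth_iota // add0n uv.
Qed.

Lemma dist_lt_walk u v : dist G u v < #|T| -> has_walk G u v (dist G u v).
Proof.
move=> lt; have : has (has_walk G u v) (iota 0 #|T|).
  by rewrite has_find size_iota.
by move/(nth_find 0); rewrite nth_iota.
Qed.

(** Removing repetitions leaves a walk with fewer than [#|T|] edges, so the search in [dist]
    succeeds. *)
Lemma dist_walk u v : connect (adj G) u v -> has_walk G u v (dist G u v).
Proof.
case/connectP => p up ->; case/shortenP: up => q uq Uq _.
apply: dist_lt_walk; have uqs : has_walk G u (last u q) (size q).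
  by apply/has_walkP; exists q.
apply: leq_ltn_trans (dist_min uqs) _.
by have := max_card (mem (u :: q)); rewrite (card_uniqP Uq).
Qed.

Lemma dist_sym u v : dist G u v = dist G v u.
Proof.
by rewrite /dist; apply: eq_find => n; apply/idP/idP => /has_walk_sym.
Qed.

(** If a distance on the right has the default value [#|T|], the bound [dist_max] suffices;
    otherwise both are lengths of walks, which are concatenated. *)
Lemma dist_triangle u v w : dist G u w <= dist G u v + dist G v w.
Proof.
have [uv|uv] := ltnP (dist G u v) #|T|; last first.
  by apply: leq_trans (leq_addr _ _); apply: leq_trans uv; exact: dist_max.
have [vw|vw] := ltnP (dist G v w) #|T|; last first.
  by apply: leq_trans (leq_addl _ _); apply: leq_trans vw; exact: dist_max.
by apply/dist_min/(has_walk_trans (dist_lt_walk uv)); exact: dist_lt_walk.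
Qed.

Lemma dist_refl u : dist G u u = 0.
Proof. by apply/eqP; rewrite -leqn0 dist_min ?has_walk_refl. Qed.

Lemma dist_eq0 u v : dist G u v = 0 -> u = v.
Proof.
move=> uv; apply: has_walk0; rewrite -uv; apply: dist_lt_walk.
by rewrite uv; apply/card_gt0P; exists u.
Qed.

Lemma dist_eq1 u v : dist G u v = 1 -> adj G u v.
Proof.
move=> uv; apply: has_walk1; rewrite -uv; apply: dist_lt_walk.
(* A distance of one is not the default value [#|T|], as [u] and [v] are distinct elements of
   [T]. *)
rewrite uv; apply/card_gt1P; exists u, v; split=> //.
by apply/eqP => e; rewrite e dist_refl in uv.
Qed.

Lemma dist_adj u v : adj G u v -> dist G u v = 1.
Proof.
move=> uv; have := dist_min (has_walk_adj uv).
suff : dist G u v <> 0 by lia.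
by move/dist_eq0 => e; rewrite e adj_irrefl in uv.
Qed.

End Walks.

Lemma has_walk_sub (T : finType) (H G : sgraph T) u v n :
  subgraph H G -> has_walk H u v n -> has_walk G u v n.
Proof.
move=> [_ HG] /has_walkP[p [sp up lp]]; apply/has_walkP; exists p; split=> //.
exact: sub_path up.
Qed.

Lemma leq_dist (T : finType) (H G : sgraph T) u v :
  (forall n, has_walk G u v n -> exists2 m, m <= n & has_walk H u v m) ->
  dist H u v <= dist G u v.
Proof.
move=> GH; have [uv|uv] := ltnP (dist G u v) #|T|.
  have [m lem /dist_min] := GH _ (dist_lt_walk uv); lia.
by apply: leq_trans uv; exact: dist_max.
Qed.

(** * Forbidden subgraphs of median graphs *)

Section MedianGraphs.
Variables (T : finType) (G : sgraph T).

(** For the median of a triangle, the left sides of the three equations add up to an even number,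
    the right sides to three. *)
Lemma median_triangle_free a b c : median_graph G ->
  adj G a b -> adj G b c -> ~~ adj G a c.
Proof.
move=> [_ med] ab bc; apply/negP => ac.
have aG := adj_vset ab; have bG := adj_vset bc.
have cG : c \in vset G by apply: (@adj_vset _ _ _ a); rewrite adj_sym.
have [x [[_ + + +] _]] := med _ _ _ aG bG cG.
rewrite (dist_adj ab) (dist_adj ac) (dist_adj bc).
rewrite (dist_sym G x b); lia.
Qed.

Lemma dist_opposite a b c : median_graph G ->
  adj G a b -> adj G b c -> a != c -> dist G a c = 2.
Proof.
move=> mG ab bc ac; have /negP nac := median_triangle_free mG ab bc.
have := dist_triangle G a b c; rewrite (dist_adj ab) (dist_adj bc).
have := @dist_eq0 _ G a c; have := @dist_eq1 _ G a c.
move: (dist G a c) => [|[|[|//]]] // H1 H0 _.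
  by rewrite H0 ?eqxx in ac.
by case: nac; exact: H1.
Qed.

(* The graph K_{2,3} is excluded since its three vertices of degree two have
   both others as medians. *)
Lemma square_between a b c d m : median_graph G -> a != c -> b != d ->
  adj G a b -> adj G b c -> adj G c d -> adj G d a -> m \in vset G ->
  dist G a m + dist G m c = dist G a c -> m \in [:: a; b; c; d].
Proof.
move=> mG nac nbd ab bc cd da mV; rewrite (dist_opposite mG ab bc nac) => amc.
rewrite !inE; case: (eqVneq m a) => //= ma; case: (eqVneq m b) => //= mb.
case: (eqVneq m c) => //= mc; case: (eqVneq m d) => //= md.
have adjC := adj_sym G.
have am0 : dist G a m <> 0 by move/dist_eq0=> e; rewrite e eqxx in ma.
have mc0 : dist G m c <> 0 by move/dist_eq0=> e; rewrite e eqxx in mc.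
(* A further common neighbour [m] of [a] and [c] makes a $K_{2,3}$ with sides [a], [c] and [b], [d],
   [m]. *)
have [am1 mc1] : dist G a m = 1 /\ dist G m c = 1 by clear -amc am0 mc0; lia.
have am := dist_eq1 am1; have cm : adj G c m by rewrite adjC dist_eq1.
have cb : adj G c b by rewrite adjC.
have ba : adj G b a by rewrite adjC.
have ad : adj G a d by rewrite adjC.
have dc : adj G d c by rewrite adjC.
have [_ /(_ b d m)] := mG.
have [aV bV cV dV] := And4 (adj_vset ab) (adj_vset bc) (adj_vset cd) (adj_vset da).
move=> /(_ bV dV mV)[x [_ xU]].
have bd2 := dist_opposite mG bc cd nbd.
have bm2 : dist G b m = 2 by apply: dist_opposite mG ba am _; rewrite eq_sym.
have dm2 : dist G d m = 2 by apply: dist_opposite mG da am _; rewrite eq_sym.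
have xa : x = a.
  by apply: xU; split; rewrite // ?bd2 ?bm2 ?dm2 !(dist_adj ba, dist_adj am, dist_adj ad, dist_adj da).
have xc : x = c.
  by apply: xU; split; rewrite // ?bd2 ?bm2 ?dm2 !(dist_adj bc, dist_adj cm, dist_adj dc, dist_adj cd).
by rewrite -xa xc eqxx in nac.
Qed.

End MedianGraphs.

(** * Squares: chords and gates *)

Section Squares.
Variables (T : finType) (C : sgraph T).
Hypothesis sqC : is_square C.

Lemma squareP : exists a b c d, [/\ vset C =i [:: a; b; c; d],
  a != c, b != d & [/\ adj C a b, adj C b c, adj C c d & adj C d a]].
Proof.
have [[|a [|b [|c [|d [|? ?]]]]] [] // _ U VC adjC] := sqC.
move: (U) => /=; rewrite !inE !negb_or -!andbA.
move=> /and5P[nab nac nad nbc /and3P[nbd ncd _]].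
exists a, b, c, d; split=> //; first by move=> x; rewrite VC inE.
by split; rewrite adjC !inE /= !eqxx ?orbT //=;
  rewrite !(eq_sym b a, eq_sym c a, eq_sym d a, eq_sym c b, eq_sym d b, eq_sym d c)
          ?(negPf nab, negPf nac, negPf nad, negPf nbc, negPf nbd, negPf ncd) ?eqxx ?orbT.
Qed.

Lemma square_path2 x y : x \in vset C -> y \in vset C ->
  [\/ x = y, adj C x y | exists2 z, adj C x z & adj C z y].
Proof.
have [a [b [c [d [VC _ _ [ab bc cd da]]]]]] := squareP.
have sC := adj_sym C; rewrite !VC !inE => /or4P[]/eqP-> /or4P[]/eqP->;
  by [constructor 1 | constructor 2; rewrite // sC
     |constructor 3; (exists a + exists b); rewrite // sC].
Qed.

(** When [C] is a subgraph of [H], this says that [C] is induced in [H]. *)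
Definition chordless (H : sgraph T) :=
  {in vset C &, forall x y, adj H x y -> adj C x y}.

(** Vertices of a square that are neither equal nor adjacent in it have a common neighbour there, so
    a chord would close a triangle. *)
Lemma median_chordless (H : sgraph T) :
  subgraph C H -> median_graph H -> chordless H.
Proof.
move=> [_ CH] mH x y xC yC xy.
case: (square_path2 xC yC) => [e||[z xz zy]] //; first by rewrite e adj_irrefl in xy.
by have /negP[] := median_triangle_free mH (CH _ _ xz) (CH _ _ zy).
Qed.

(** A single edge between vertices of [C] is in [C] by chordlessness, and from length two on the
    diameter of the square is enough. *)
Lemma chordless_walk (H : sgraph T) x y n : chordless H ->
  x \in vset C -> y \in vset C -> has_walk H x y n ->
  exists2 m, m <= n & has_walk C x y m.
Proof.
move=> HC xC yC; case: n => [/has_walk0->|[/has_walk1 xy|n _]].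
- by exists 0; rewrite ?has_walk_refl.
- by exists 1; rewrite // has_walk_adj ?HC.
case: (square_path2 xC yC) => [->|/has_walk_adj xy|[z /has_walk_adj xz /has_walk_adj zy]].
- by exists 0; rewrite ?has_walk_refl.
- by exists 1.
- by exists 2 => //; exact: has_walk_trans xz zy.
Qed.

(* The medians of w with the two diagonals of C are corners of C, and they can
   only coincide; this corner is the gate. *)
Lemma median_square_gate (H : sgraph T) w :
  subgraph C H -> median_graph H -> w \in vset H ->
  exists2 g, g \in vset C &
    forall c, c \in vset C -> dist H w c = dist H w g + dist H g c.
Proof.
move=> [VCH CH] mH wH; have [a [b [c [d [VC nac nbd]]]]] := squareP.
case=> /CH ab /CH bc /CH cd /CH da.
have cV := adj_vset cd; have bV := adj_vset bc.
have aV := adj_vset ab; have dV := adj_vset da.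
have ndb : d != b by rewrite eq_sym.
have [m [[mV wma amc wmc] _]] := mH.2 _ _ _ wH aV cV.
have [m' [[m'V wmb bmd wmd] _]] := mH.2 _ _ _ wH bV dV.
have mC := square_between mH nac nbd ab bc cd da mV amc.
have m'C : m' \in [:: b; c; d; a].
  by apply: square_between mH _ _ bc cd da ab m'V bmd; rewrite // eq_sym.
have ac := dist_opposite mH ab bc nac; have bd := dist_opposite mH bc cd nbd.
have dG := dist_sym H; have d0 := dist_refl H.
have tri := dist_triangle H w.
move: (dist_adj ab) (dist_adj bc) (dist_adj cd) (dist_adj da) => {}ab {}bc {}cd {}da.
move: (dG a b) (dG b c) (dG c d) (dG d a) (dG a c) (dG b d) => ba cb dc ad ca db.
move: (tri a b) (tri b a) (tri b c) (tri c b) => {dG}.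
move: (tri c d) (tri d c) (tri d a) (tri a d) => {tri}.
move: mC m'C; rewrite !inE => mC m'C t1 t2 t3 t4 t5 t6 t7 t8.
(* Along a side of [C] the distance from [w] changes by at most one ([t1] to [t8]); this contradicts
   the median equations if the two corners differ. *)
have mm' : m = m'.
  move: mC m'C => /or4P[]/eqP em /or4P[]/eqP em'; rewrite ?em ?em' //;
  exfalso; rewrite ?{}em ?{}em' ?d0 in wma wmb wmd wmc;
  clear -wma wmb wmd wmc ab bc cd da ba cb dc ad ac bd ca db t1 t2 t3 t4 t5 t6 t7 t8; lia.
exists m => [|x]; rewrite VC !inE // => xC; subst m'.
move: mC xC => /or4P[]/eqP em /or4P[]/eqP->; rewrite {}em ?d0 in wma wmb wmd wmc *.
all: clear -wma wmb wmd wmc ab bc cd da ba cb dc ad ac bd ca db t1 t2 t3 t4 t5 t6 t7 t8; lia.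
Qed.

End Squares.

(** * Amalgams along a common subgraph *)

(** The last two fields make [C] a separator: no edge of [G] joins a vertex of [G1] outside [C] to
    one of [G2] outside [C]. *)
Record amalgam (T : finType) (G G1 G2 C : sgraph T) : Prop := Amalgam {
  amalgam_sub1 : subgraph G1 G;
  amalgam_sub2 : subgraph G2 G;
  amalgam_subC1 : subgraph C G1;
  amalgam_subC2 : subgraph C G2;
  amalgam_vset : forall x, x \in vset G -> x \in vset G1 \/ x \in vset G2;
  amalgam_cap : forall x, x \in vset G1 -> x \in vset G2 -> x \in vset C;
  amalgam_adj : forall x y, adj G x y -> adj G1 x y \/ adj G2 x y
}.

Lemma amalgam_sym (T : finType) (G G1 G2 C : sgraph T) :
  amalgam G G1 G2 C -> amalgam G G2 G1 C.
Proof.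
case=> s1 s2 c1 c2 V I E; split=> // [x /V|x x1 x2|x y /E]; [|exact: I|];
  by case; [right | left].
Qed.

Lemma between_sym (T : finType) (G : sgraph T) u x v :
  dist G u x + dist G x v = dist G u v -> dist G v x + dist G x u = dist G v u.
Proof. by rewrite addnC !(dist_sym G v) (dist_sym G x u). Qed.

Lemma is_median_rot (T : finType) (G : sgraph T) u v w x :
  is_median G u v w x -> is_median G v w u x.
Proof. by case=> xG /between_sym e1 e2 /between_sym. Qed.

Lemma ex_unique_iff (T : Type) (P Q : T -> Prop) :
  (forall x, P x <-> Q x) -> (exists! x, P x) -> exists! x, Q x.
Proof.
move=> PQ [x [Px Ux]]; exists x; split; first exact/PQ.
by move=> y /PQ; exact: Ux.
Qed.

(** * Distances in an amalgam along a square *)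

Section AmalgamMetric.
Variables (T : finType) (C : sgraph T).
Hypothesis sqC : is_square C.

Lemma square_nonempty : exists c, c \in vset C.
Proof.
by have [a [b [c [d [VC _ _ _]]]]] := squareP sqC; exists a; rewrite VC inE eqxx.
Qed.

Section Metric.
Variables (G G1 G2 : sgraph T).
Hypothesis amG : amalgam G G1 G2 C.
Hypothesis CG2 : chordless C G2.

Let V1G x (x1 : x \in vset G1) : x \in vset G :=
  fintype.subsetP (amalgam_sub1 amG).1 x x1.

(** Both claims are proved together by induction on the length: the second keeps track of an
    excursion into [G2] since its departure from [C], and the first closes it when it comes back. *)
Lemma amalgam_walk u v n : u \in vset G1 -> has_walk G u v n ->
  (v \in vset G1 -> exists2 m, m <= n & has_walk G1 u v m) /\
  (v \in vset G2 -> exists c a b,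
     [/\ c \in vset C, a + b <= n, has_walk G1 u c a & has_walk G2 c v b]).
Proof.
move=> u1; elim: n v => [v /has_walk0 <-|n IH v /has_walkS[w /IH{IH}[IH1 IH2]]].
  split=> [_|u2]; first by exists 0; rewrite ?has_walk_refl.
  exists u, 0, 0; rewrite !has_walk_refl; split=> //; exact: amalgam_cap amG _ u1 u2.
case/(amalgam_adj amG) => wv; have [wV vV] := adj_vset2 wv.
  have [m mn uw] := IH1 wV; have uv := has_walk_trans uw (has_walk_adj wv).
  split=> [_|v2]; first by exists (m + 1) => //; rewrite addn1.
  exists v, (m + 1), 0; rewrite has_walk_refl; split=> //; last by rewrite addn0 addn1.
  exact: amalgam_cap amG _ vV v2.
have [c [a [b [cC abn uc cw]]]] := IH2 wV.
have cv := has_walk_trans cw (has_walk_adj wv).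
split=> [v1|_]; last first.
  by exists c, a, (b + 1); split=> //; rewrite addnA addn1.
have vC := amalgam_cap amG v1 vV.
(* The excursion from [c] to [v] is replaced by a walk on [C], which is no longer and also lies in
   [G1]. *)
have [m mb cv1] := chordless_walk sqC CG2 cC vC cv.
exists (a + m); first by clear -abn mb; lia.
exact: has_walk_trans uc (has_walk_sub (amalgam_subC1 amG) cv1).
Qed.

Lemma amalgam_dist u v :
  u \in vset G1 -> v \in vset G1 -> dist G1 u v = dist G u v.
Proof.
move=> u1 v1; apply/eqP; rewrite eqn_leq; apply/andP; split; apply: leq_dist.
  by move=> n /(amalgam_walk u1)[/(_ v1)].
by move=> n uv; exists n => //; exact: has_walk_sub (amalgam_sub1 amG) uv.
Qed.

Lemma amalgam_connected1 : connected_graph G -> connected_graph G1.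
Proof.
move=> cG u v u1 v1; apply/connect_walk.
have /connect_walk[n] := cG _ _ (V1G u1) (V1G v1).
by move=> /(amalgam_walk u1)[/(_ v1)[m _ ?] _]; exists m.
Qed.

(** A shortest walk is split by [amalgam_walk] at a vertex of [C]. *)
Lemma amalgam_dist_cross u v : connected_graph G ->
  u \in vset G1 -> v \in vset G2 ->
  exists2 c, c \in vset C & dist G u v = dist G u c + dist G c v.
Proof.
move=> cG u1 v2; have v0 : v \in vset G.
  exact: fintype.subsetP (amalgam_sub2 amG).1 v v2.
have [_ /(_ v2)[c [a [b [cC abn uc cv]]]]] :=
  amalgam_walk u1 (dist_walk (cG _ _ (V1G u1) v0)).
exists c => //; apply/eqP; rewrite eqn_leq dist_triangle /=.
apply: leq_trans abn; apply: leq_add; apply: dist_min.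
  exact: has_walk_sub (amalgam_sub1 amG) uc.
exact: has_walk_sub (amalgam_sub2 amG) cv.
Qed.

End Metric.

(** * Gates and convexity of one side *)

Section Gates.
Variables (G G1 G2 : sgraph T).
Hypothesis amG : amalgam G G1 G2 C.
Hypothesis CG2 : chordless C G2.
Hypothesis cG : connected_graph G.
(** The distances are those of [G], so that the gates can come from a median [G] as well as from a
    median [G2] that is isometric in [G]. *)
Hypothesis gate2 : forall w, w \in vset G2 -> exists2 g, g \in vset C &
  forall c, c \in vset C -> dist G w c = dist G w g + dist G g c.

Let V1 x (xC : x \in vset C) : x \in vset G1 :=
  fintype.subsetP (amalgam_subC1 amG).1 x xC.
Let V1G x (x1 : x \in vset G1) : x \in vset G :=
  fintype.subsetP (amalgam_sub1 amG).1 x x1.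

(** For $w$ in [G2] with gate $g$ in [C], crossing [C] at $c$ gives $d(w,x) = d(w,g) + d(g,c) +
    d(c,x) \ge d(w,g) + d(g,x)$. *)
Lemma amalgam_gate w : w \in vset G -> exists2 g, g \in vset G1 &
  forall x, x \in vset G1 -> dist G w x = dist G w g + dist G g x.
Proof.
case/(amalgam_vset amG) => [w1|w2].
  by exists w => // x _; rewrite dist_refl.
have [g gC gw] := gate2 w2; exists g; first exact: V1.
move=> x x1; have [c cC e] := amalgam_dist_cross amG CG2 cG x1 w2.
apply/eqP; rewrite eqn_leq dist_triangle /= (dist_sym G w x) e (addnC (dist G x c)).
rewrite (dist_sym G c w) (gw c cC) -addnA leq_add2l (dist_sym G x c).
exact: dist_triangle.
Qed.

(** Convexity of [G1]: with $g$ the gate of $x$, $d(u,v) = 2d(x,g) + d(u,g) + d(g,v) \ge 2d(x,g) +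
    d(u,v)$, so $x = g$. *)
Lemma amalgam_between u v x : u \in vset G1 -> v \in vset G1 ->
  x \in vset G -> dist G u x + dist G x v = dist G u v -> x \in vset G1.
Proof.
move=> u1 v1 xG e; have [g g1 gP] := amalgam_gate xG.
suff /dist_eq0-> : dist G x g = 0 by [].
have := gP _ u1; have := gP _ v1; have := dist_triangle G u g v.
rewrite (dist_sym G u x) (dist_sym G u g) in e *.
by move: e; clear; lia.
Qed.

Lemma is_median_amalgam u v w x : u \in vset G1 -> v \in vset G1 ->
  w \in vset G1 -> is_median G1 u v w x <-> is_median G u v w x.
Proof.
have dE := amalgam_dist amG CG2.
move=> u1 v1 w1; split=> -[xV e1 e2 e3].
  by rewrite !dE // in e1 e2 e3; split=> //; exact: V1G.
have x1 := amalgam_between u1 v1 xV e1.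
by split; rewrite // !dE.
Qed.

Lemma median_graph_amalgam1 : median_graph G -> median_graph G1.
Proof.
move=> [_ mG]; split; first exact: amalgam_connected1 amG CG2 cG.
move=> u v w u1 v1 w1.
apply: ex_unique_iff (mG _ _ _ (V1G u1) (V1G v1) (V1G w1)) => x.
by split=> /is_median_amalgam; apply.
Qed.

(* The median of u, v, w is the one of u, v and the gate of w in G1. *)
Lemma amalgam_median2 u v w : median_graph G1 ->
  u \in vset G1 -> v \in vset G1 -> w \in vset G ->
  exists! x, is_median G u v w x.
Proof.
move=> [_ mG1] u1 v1 wG; have [g g1 gP] := amalgam_gate wG.
apply: ex_unique_iff (mG1 _ _ _ u1 v1 g1) => x.
(* On [G1] the distances to [w] and to [g] differ by a constant, which cancels in the median
   equations. *)
have gw y : y \in vset G1 -> dist G y w = dist G y g + dist G g w.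
  by move=> y1; rewrite dist_sym gP // addnC (dist_sym G w) (dist_sym G g y).
split=> [/is_median_amalgam[] // xG e1 e2 e3|[xG e1 e2 e3]].
  have x1 := amalgam_between u1 v1 xG e1.
  by split=> //; rewrite (gw x x1) ?(gw v v1) ?(gw u u1) addnA ?e2 ?e3.
have x1 := amalgam_between u1 v1 xG e1.
apply/is_median_amalgam => //; split=> //; apply: (@addIn (dist G g w)); rewrite -addnA -(gw x x1).
  by rewrite -(gw v v1).
by rewrite -(gw u u1).
Qed.

End Gates.

(** * Transfer of the median property between an amalgam and its sides *)

Variables (G G1 G2 : sgraph T).
Hypothesis amG : amalgam G G1 G2 C.

Lemma chordless_sub (H : sgraph T) :
  subgraph H G -> chordless C G -> chordless C H.
Proof. by move=> [_ HG] CG x y xC yC /HG; exact: CG. Qed.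

Lemma subgraph_trans (H : sgraph T) :
  subgraph C H -> subgraph H G -> subgraph C G.
Proof.
move=> [VCH CH] [VHG HG]; split; first exact: fintype.subset_trans VCH VHG.
by move=> x y /CH/HG.
Qed.

(** The square is chordless and gated in [G] itself, and chordlessness passes to the two sides. *)
Lemma median_graph_amalgamW : median_graph G -> median_graph G1.
Proof.
move=> mG; have CG := subgraph_trans (amalgam_subC1 amG) (amalgam_sub1 amG).
have chG := median_chordless sqC CG mG.
have ch1 := chordless_sub (amalgam_sub1 amG) chG.
have ch2 := chordless_sub (amalgam_sub2 amG) chG.
apply: (median_graph_amalgam1 amG) => //; first by case: mG.
move=> w w2; apply: (median_square_gate sqC CG mG).
exact: fintype.subsetP (amalgam_sub2 amG).1 w w2.
Qed.

Lemma amalgam_connected :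
  connected_graph G1 -> connected_graph G2 -> connected_graph G.
Proof.
move=> c1 c2; have [c cC] := square_nonempty.
have toc x : x \in vset G -> connect (adj G) x c.
  move=> /(amalgam_vset amG)[] xV; apply/connect_walk.
    have /connect_walk[n xc] := c1 _ _ xV (fintype.subsetP (amalgam_subC1 amG).1 c cC).
    by exists n; exact: has_walk_sub (amalgam_sub1 amG) xc.
  have /connect_walk[n xc] := c2 _ _ xV (fintype.subsetP (amalgam_subC2 amG).1 c cC).
  by exists n; exact: has_walk_sub (amalgam_sub2 amG) xc.
move=> u v /toc uc /toc/connect_walk[n vc]; apply: connect_trans uc _.
by apply/connect_walk; exists n; exact: has_walk_sym.
Qed.

End AmalgamMetric.

Lemma unique_median_rot (T : finType) (G : sgraph T) u v w :
  (exists! x, is_median G u v w x) -> exists! x, is_median G v w u x.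
Proof.
apply: ex_unique_iff => x; split=> [|/is_median_rot/is_median_rot //].
exact: is_median_rot.
Qed.

(** The gates that the median graph [G2] provides are gates for the distance of [G], since [G2] is
    isometric in [G]. *)
Lemma amalgam_median (T : finType) (G G1 G2 C : sgraph T) u v w :
  is_square C -> amalgam G G1 G2 C -> median_graph G1 -> median_graph G2 ->
  u \in vset G1 -> v \in vset G1 -> w \in vset G ->
  exists! x, is_median G u v w x.
Proof.
move=> sqC amG mG1 mG2 u1 v1 wG.
have ch1 := median_chordless sqC (amalgam_subC1 amG) mG1.
have ch2 := median_chordless sqC (amalgam_subC2 amG) mG2.
have cG := amalgam_connected sqC amG mG1.1 mG2.1.
apply: (amalgam_median2 sqC amG ch2 cG) => // x x2.
have [g gC gP] := median_square_gate sqC (amalgam_subC2 amG) mG2 x2.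
have C2 := fintype.subsetP (amalgam_subC2 amG).1.
have dE := amalgam_dist sqC (amalgam_sym amG) ch1.
exists g => // c cC; have [gV cV] := (C2 _ gC, C2 _ cC).
by rewrite -(dE _ _ x2 cV) -(dE _ _ x2 gV) -(dE _ _ gV cV) gP.
Qed.

Lemma median_graph_amalgam (T : finType) (G G1 G2 C : sgraph T) :
  is_square C -> amalgam G G1 G2 C ->
  median_graph G <-> median_graph G1 /\ median_graph G2.
Proof.
move=> sqC amG; have amG' := amalgam_sym amG; split=> [mG|[m1 m2]].
  by split; [exact: median_graph_amalgamW amG mG | exact: median_graph_amalgamW amG' mG].
split; first exact (amalgam_connected sqC amG m1.1 m2.1).
have P1 := amalgam_median sqC amG m1 m2; have P2 := amalgam_median sqC amG' m2 m1.
move=> u v w uG vG wG.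
case: (amalgam_vset amG uG) (amalgam_vset amG vG) (amalgam_vset amG wG)
  => [] u_ [] v_ [] w_.
(* Two of the three vertices are on the same side; a rotation puts them first. *)
all: solve [exact: P1 | exact: P2
  | exact/unique_median_rot/P1 | exact/unique_median_rot/P2
  | exact/unique_median_rot/unique_median_rot/P1
  | exact/unique_median_rot/unique_median_rot/P2].
Qed.

Local Open Scope classical_set_scope.

(** * Connectedness of arcs without endpoints *)

Section SimpleArcs.
Variables (R : realType) (A : set (R * R)) (p q : R * R).
Hypothesis arcA : simple_arc A p q.

Let unit_param (gamma : R -> R * R) := [/\ gamma 0%R = p, gamma 1%R = q &
  forall s t : R, (0 <= s <= 1)%R -> (0 <= t <= 1)%R -> gamma s = gamma t -> s = t].

Let arc_param : exists gamma : R -> R * R, [/\ {within `[0%R, 1%R], continuous gamma},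
  unit_param gamma & A = gamma @` `[0%R, 1%R]].
Proof.
have [gamma [cg ig g0 g1 ->]] := arcA; exists gamma; split=> //; split=> // s t s01 t01.
by apply: ig; apply: mem_set; rewrite /= in_itv.
Qed.

(** The remaining part of the arc is the continuous image of the interval [J]. The equation is asked
    for every parametrization because [simple_arc] only asserts that one exists. *)
Let connected_arc_minus (J : set R) (B : set (R * R)) :
  is_interval J -> J `<=` `[0%R, 1%R] ->
  (forall gamma, unit_param gamma ->
    (gamma @` `[0%R, 1%R]) `\` B = gamma @` J) ->
  connected (A `\` B).
Proof.
move=> iJ J01 e; have [gamma [cg ug ->]] := arc_param.
rewrite (e gamma) //; apply: connected_continuous_connected.
  exact/connected_intervalP.
exact: continuous_subspaceW cg.
Qed.

Lemma simple_arc_open_connected : connected (A `\` [set p; q]).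
Proof.
apply: (@connected_arc_minus `]0%R, 1%R[).
- exact: interval_is_interval.
- exact: subset_itvW.
move=> gamma [<- <- ig]; apply/seteqP; split=> [_ [[t t01 <-] tne]|_ [t t01 <-]].
  exists t => //; move: t01; rewrite /= !in_itv /= => /andP[t0 t1].
  rewrite !lt_neqAle t0 t1 !andbT; apply/andP; split; apply/eqP => e; apply: tne;
    by [left; rewrite e | right; rewrite e].
move: t01; rewrite /= in_itv /= => /andP[t0 t1]; split.
  by exists t; rewrite //= in_itv /= !ltW.
by case=> /ig; rewrite !lexx ler01 !ltW // => /(_ isT isT) e;
  rewrite e ltxx in t0 t1.
Qed.

(** Keeping [p] ties the face of a vertex to that of the edges leaving it. *)
Lemma simple_arc_half_open_connected : connected (A `\` [set q]).
Proof.
apply: (@connected_arc_minus `[0%R, 1%R[).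
- exact: interval_is_interval.
- by apply: subset_itvl; rewrite bnd_simp.
move=> gamma [_ <- ig]; apply/seteqP; split=> [_ [[t t01 <-] tne]|_ [t t01 <-]].
  exists t => //; move: t01; rewrite /= !in_itv /= => /andP[t0 t1].
  by rewrite lt_neqAle t0 t1 !andbT; apply/eqP => e; apply: tne; rewrite e.
move: t01; rewrite /= in_itv /= => /andP[t0 t1]; split.
  by exists t; rewrite //= in_itv /= t0 ltW.
by move=> /ig; rewrite !lexx ler01 t0 ltW // => /(_ isT isT) e; rewrite e ltxx in t1.
Qed.

Lemma simple_arc_interior_nonempty : A `\` [set p; q] !=set0.
Proof.
have [gamma [_ [<- <- ig] ->]] := arc_param.
have h0 : (0 < 2^-1 :> R)%R by rewrite invr_gt0.
have h1 : (2^-1 < 1 :> R)%R by rewrite invf_lt1 ?ltr1n.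
exists (gamma 2^-1%R); split; first by exists 2^-1%R; rewrite //= in_itv /= !ltW.
by case=> /ig; rewrite !lexx ler01 !ltW // => /(_ isT isT) e; rewrite e ltxx in h0 h1.
Qed.

Lemma simple_arc_start : A p.
Proof.
by have [gamma [_ _ <- _ ->]] := arcA; exists 0%R => //=; rewrite in_itv /= lexx ler01.
Qed.

End SimpleArcs.

(** * Inner and outer faces *)

Section Faces.
Variables (R : realType) (T : finType) (C : sgraph T) (pi : embedding R C).

Lemma face_disjoint p : inner_face pi p -> ~ outer_face pi p.
Proof. by move=> [_ b] [_ /(_ b)]. Qed.

Lemma face_cover p : ~ drawing pi p -> inner_face pi p \/ outer_face pi p.
Proof. by move=> Dp; case: (pselect (bounded_set (face_at pi p))); [left | right]. Qed.

(** All points of [A] have the same component in the complement of the drawing, which is either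
    bounded or not. *)
Lemma connected_inner_outer (A : set (R * R)) : connected A ->
  A `<=` ~` drawing pi -> A `<=` inner_face pi \/ A `<=` outer_face pi.
Proof.
move=> cA AD; have [[p Ap]|/nonemptyPn->] := pselect (A !=set0); last by left.
have faceE q : A q -> face_at pi q = face_at pi p.
  by move=> Aq; apply/esym/same_connected_component; exists A.
have [[_ bp]|[_ bp]] := face_cover (AD _ Ap); [left|right] => q Aq;
  by split; [exact: AD | rewrite faceE].
Qed.

End Faces.

(** * The inner and outer graphs form an amalgam *)

Section Split.
Variables (R : realType) (T : finType) (G C : sgraph T) (pi : embedding R G).
Hypothesis sCG : subgraph C G.

Local Notation piC := (induced_embedding pi sCG).
Local Notation D := (drawing piC).

Lemma drawing_vertex v : v \in vset G -> D (pt pi v) <-> v \in vset C.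
Proof.
move=> vG; split=> [[[w wC /(pt_inj vG)->] //|[x [y [xy]]]]|vC].
- exact: fintype.subsetP sCG.1 w wC.
- have [xC yC] := adj_vset2 xy.
  by move=> /(curve_pt (sCG.2 _ _ xy) vG)[]->.
- by left; exists v.
Qed.

Lemma drawing_edge u v : adj G u v -> ~~ adj C u v ->
  open_curve pi u v `<=` ~` D.
Proof.
move=> uv nuv p [cp np] [[w wC pw]|[x [y [xy cxy]]]].
  have wG := fintype.subsetP sCG.1 w wC.
  by rewrite pw in cp np; apply: np; case: (curve_pt uv wG cp) => ->; [left|right].
(* With the same ends, [uv] would be the edge [xy] of [C]; distinct edges meet only in vertices. *)
have ne : [set u; v]%SET <> [set x; y]%SET.
  move=> e; have := set21 u v; have := set22 u v; rewrite e !inE.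
  have nuv' : u != v by apply: contraTneq uv => ->; rewrite adj_irrefl.
  move=> /orP[]/eqP vE /orP[]/eqP uE; move: nuv nuv'; rewrite vE uE ?eqxx //.
    by rewrite adj_sym xy.
  by rewrite xy.
have [w wG pw] := curve_disj uv (sCG.2 _ _ xy) ne cp cxy.
by rewrite pw in cp np; apply: np; case: (curve_pt uv wG cp) => ->; [left|right].
Qed.

Lemma open_curve_neq0 u v : adj G u v -> open_curve pi u v !=set0.
Proof. by move=> uv; exact: simple_arc_interior_nonempty (curve_arc pi uv). Qed.

Lemma open_curve_connected u v : adj G u v -> connected (open_curve pi u v).
Proof. by move=> uv; exact: simple_arc_open_connected (curve_arc pi uv). Qed.

Lemma open_curve_sym u v : adj G u v -> open_curve pi u v = open_curve pi v u.
Proof. by move=> uv; rewrite /open_curve (curve_sym pi uv) setUC. Qed.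

(** The arc without [v] is connected and misses the drawing of [C], so it stays on the side of
    [u]. *)
Lemma edge_endpoint_face u v : adj G u v -> ~~ adj C u v -> ~ D (pt pi u) ->
  (inner_face piC (pt pi u) -> open_curve pi u v `<=` inner_face piC) /\
  (outer_face piC (pt pi u) -> open_curve pi u v `<=` outer_face piC).
Proof.
move=> uv nuv Du; have arc := curve_arc pi uv.
set A := curve pi u v `\` [set pt pi v].
have [uV vV] := adj_vset2 uv.
have uA : A (pt pi u).
  split; first exact: simple_arc_start arc.
  by move=> /(pt_inj uV vV) e; rewrite e adj_irrefl in uv.
have oA : open_curve pi u v `<=` A by move=> p [cp np]; split=> // pv; apply: np; right.
have AD : A `<=` ~` D.
  move=> p [cp pv]; have [->//|pu] := pselect (p = pt pi u).
  by apply: (drawing_edge uv nuv); split=> // -[].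
have [Ain|Aout] := connected_inner_outer (simple_arc_half_open_connected arc) AD.
  by split=> [_ p /oA/Ain//|/(face_disjoint (Ain _ uA))].
by split=> [/face_disjoint/(_ (Aout _ uA))|_ p /oA/Aout].
Qed.

Lemma delete_vset_in (F : set (R * R)) v :
  v \in delete_vset pi F <-> v \in vset G /\ ~ F (pt pi v).
Proof.
rewrite inE; split=> [/andP[-> /asboolPn]|[-> nF]] //=.
exact/asboolPn.
Qed.

Lemma delete_adjP (F : set (R * R)) u v : delete_adj pi F u v <->
  [/\ adj G u v, ~ F (pt pi u), ~ F (pt pi v) & ~ (open_curve pi u v `<=` F)].
Proof.
split=> [/and4P[uv /delete_vset_in[_ uF] /delete_vset_in[_ vF] /asboolPn nF]//|].
move=> [uv uF vF nF]; have [uV vV] := adj_vset2 uv.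
by apply/and4P; split=> //; [exact/delete_vset_in|exact/delete_vset_in|exact/asboolPn].
Qed.

Lemma delete_region_sub (F : set (R * R)) : subgraph (delete_region pi F) G.
Proof.
split; first by apply/fintype.subsetP => v /delete_vset_in[].
by move=> u v /delete_adjP[].
Qed.

(** The open arc of an edge of [C] is nonempty and lies on [D], hence is not contained in [F]. *)
Lemma sub_delete_region (F : set (R * R)) : F `<=` ~` D ->
  subgraph C (delete_region pi F).
Proof.
move=> FD; have VC v : v \in vset C -> v \in vset G.
  exact: fintype.subsetP sCG.1 v.
have nF v : v \in vset C -> ~ F (pt pi v).
  by move=> vC /FD; apply; apply/drawing_vertex => //; exact: VC.
split; first by apply/fintype.subsetP => v vC; apply/delete_vset_in; split; auto.
move=> u v uv; have [uC vC] := adj_vset2 uv; have uvG := sCG.2 _ _ uv.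
apply/delete_adjP; split; auto => oF; have [p op] := open_curve_neq0 uvG.
by apply: (FD _ (oF _ op)); right; exists u, v; split=> //; case: op.
Qed.

Lemma amalgam_in_out : amalgam G (G_in pi sCG) (G_out pi sCG) C.
Proof.
split; try exact: delete_region_sub.
- by apply: sub_delete_region => p [].
- by apply: sub_delete_region => p [].
- move=> v vG; have [i|ni] := pselect (inner_face piC (pt pi v)).
    by left; apply/delete_vset_in; split=> //; exact: face_disjoint.
  by right; apply/delete_vset_in.
- move=> v /delete_vset_in[vG no] /delete_vset_in[_ ni].
  by apply/drawing_vertex => //; apply: contrapT => /face_cover[].
move=> u v uv; have [uvC|nuv] := boolP (adj C u v).
  by left; apply: (sub_delete_region _).2 => // p [].
have [p op] := open_curve_neq0 uv; have vu : adj G v u by rewrite adj_sym.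
have nvu : ~~ adj C v u by rewrite adj_sym.
(* The edge survives where the opposite side is deleted: an end in a deleted face would draw the
   open arc into it, and [p] would be both inner and outer. The second end is handled by reversing
   the edge. *)
have [oin|oout] :=
    connected_inner_outer (open_curve_connected uv) (drawing_edge uv nuv);
    [left|right]; apply/delete_adjP; split=> //.
- move=> ou; apply: (face_disjoint (oin _ op)).
  by apply: (edge_endpoint_face uv nuv _).2 => //; case: ou.
- move=> ov; apply: (face_disjoint (oin _ op)); rewrite open_curve_sym // in op.
  by apply: (edge_endpoint_face vu nvu _).2 => //; case: ov.
- by move=> /(_ _ op); apply: face_disjoint; exact: oin.
- move=> iu; apply/face_disjoint/(oout _ op).
  by apply: (edge_endpoint_face uv nuv _).1 => //; case: iu.
- move=> iv; apply/face_disjoint/(oout _ op); rewrite open_curve_sym // in op.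
  by apply: (edge_endpoint_face vu nvu _).1 => //; case: iv.
- by move=> /(_ _ op)/face_disjoint; apply; exact: oout.
Qed.

End Split.

Theorem theorem3p9 (R : realType) (T : finType) (G : sgraph T)
    (pi : embedding R G) (C : sgraph T) (sCG : subgraph C G)
    (hC : is_square C) :
  median_graph G <->
    median_graph (G_in pi sCG) /\ median_graph (G_out pi sCG).
Proof. exact: median_graph_amalgam hC (amalgam_in_out pi sCG). Qed.
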